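(* Consider the traffic shaping game defined in the context (homogeneous base stations and high overall slice loads), and assume the saturated regime defined there. Then at a Nash equilibrium $\boldsymbol y^*=((\tilde{\boldsymbol\rho}^{v,*},x_v^* ):v\in\mathcal V)$ of the game, the relative load distributions $\tilde{\boldsymbol\rho}^*=(\tilde{\boldsymbol\rho}^{v,*}:v\in\mathcal V)$ are the unique solution to $$\min_{(\tilde{\boldsymbol\rho}^v\in\Gamma^v:\,v\in\mathcal V)}\ \Big\|\sum_{v\in\mathcal V}s^v\tilde{\boldsymbol\rho}^v\Big\|_2^2+\sum_{v\in\mathcal V}(s^v)^2\|\tilde{\boldsymbol\rho}^v\|_2^2,$$ where $\Gamma^v=\{\tilde{\boldsymbol\rho}^v\in\mathbb R^{\mathcal B}:\langle\mathbf 1,\tilde{\boldsymbol\rho}^v\rangle=1,\ \boldsymbol M^v\tilde{\boldsymbol\rho}^v\succeq\boldsymbol0\}$, and the associated carried load of each slice $v$ is $$\rho^{v,*}=\frac1{x_v^*}=\frac{s^v(\tilde d_v-1)}{\langle\tilde{\boldsymbol g}^*,\tilde{\boldsymbol\rho}^{v,*}\rangle},\qquad \tilde{\boldsymbol g}^*=\sum_{w\in\mathcal V}s^w\tilde{\boldsymbol\rho}^{w,*}.$$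
   Context: $\mathcal B$ (base stations, $|\mathcal B|=B$) and $\mathcal V$ (slices, the players) are finite nonempty sets. Each slice $v$ has a share $s^v>0$ with $\sum_v s^v=1$; a normalized mean-delay (BTD) requirement $\tilde d_v=d_v/\delta_v$ with $s^v\tilde d_v>1$ (base stations are homogeneous: the mean reciprocal capacity $\delta_v$ of slice $v$ is the same at every base station); arrival rates $\gamma_b^v>0$; mean sojourn times $\mu_b^v>0$; and a substochastic routing matrix $\boldsymbol Q^v$ such that customers eventually leave the network (so $\boldsymbol I-(\boldsymbol Q^v)^T$ is invertible with inverse $\sum_{k\ge0}((\boldsymbol Q^v)^T)^k$). Put $\boldsymbol M^v=\mathrm{diag}(\boldsymbol\gamma^v)^{-1}(\boldsymbol I-(\boldsymbol Q^v)^T)\mathrm{diag}(\boldsymbol\mu^v)^{-1}$. A relative load $\tilde{\boldsymbol\rho}^v$ and overall carried load $\rho^v>0$ correspond to the admission probabilities $\boldsymbol a^v=\rho^v\boldsymbol M^v\tilde{\boldsymbol\rho}^v$. Traffic shaping game (SCPF sharing, high-load form of the BTD constraint). A strategy of slice $v$ is $\boldsymbol y^v=(\tilde{\boldsymbol\rho}^v,x_v)\in\mathbb R^{\mathcal B}\times\mathbb R$, $x_v=1/\rho^v$. Given the others' strategies $\boldsymbol y^{-v}$, slice $v$ minimizes $x_v$ over $$Y^v(\boldsymbol y^{-v})=\{\boldsymbol y^v:\langle\mathbf 1,\tilde{\boldsymbol\rho}^v\rangle=1,\ \boldsymbol0\preceq\boldsymbol M^v\tilde{\boldsymbol\rho}^v\preceq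 x_v\mathbf1,\ \langle\tilde{\boldsymbol g},\tilde{\boldsymbol\rho}^v\rangle\le s^v(\tilde d_v-1)x_v\},\qquad\tilde{\boldsymbol g}=\sum_{w\in\mathcal V}s^w\tilde{\boldsymbol\rho}^w.$$ A Nash equilibrium is a profile $\boldsymbol y^*$ such that, for every $v$, $\boldsymbol y^{v,*}\in Y^v(\boldsymbol y^{-v,*})$ minimizes $x_v$ over $Y^v(\boldsymbol y^{-v,*})$. Admission control under static slicing (SS). Slice $v$ maximizes $\rho^v$ over $(\tilde{\boldsymbol\rho}^v,\rho^v)$ subject to $\boldsymbol a^v=\rho^v\boldsymbol M^v\tilde{\boldsymbol\rho}^v\in[0,1]^B$, $\langle\mathbf1,\tilde{\boldsymbol\rho}^v\rangle=1$ and $\rho^v\|\tilde{\boldsymbol\rho}^v\|_2^2\le s^v\tilde d_v-1$. Saturated regime. For each slice $v$, the optimal admission control, both in the traffic shaping game (in response to any loads $\tilde{\boldsymbol\rho}^{w}\in\Gamma^w$, $w\ne v$, of the other slices) and under SS, satisfies $\boldsymbol a^v\prec\mathbf1$ (strictly, componentwise); in the game this reads $\boldsymbol M^v\tilde{\boldsymbol\rho}^v\prec x_v\mathbf1$ at the optimum. *)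

(* Defs.v *)
From HB Require Import structures.
From mathcomp Require Import all_boot all_order all_algebra.
From mathcomp Require Import all_classical all_reals all_analysis.
Set Implicit Arguments.
Unset Strict Implicit.
Unset Printing Implicit Defensive.
Import Order.TTheory GRing.Theory Num.Theory.
Import numFieldNormedType.Exports.
Local Open Scope classical_set_scope.
Local Open Scope ring_scope.

Definition is_argmin {T : Type} {R : realType} (D : set T) (f : T -> R) (x : T)
  : Prop := D x /\ forall y, D y -> f x <= f y.

Definition is_argmax {T : Type} {R : realType} (D : set T) (f : T -> R) (x : T)
  : Prop := D x /\ forall y, D y -> f y <= f x.

Definition inner {R : realType} {n : nat} (u w : 'cV[R]_n) : R :=
  \sum_b u b 0 * w b 0.

Definition sqnorm {R : realType} {n : nat} (u : 'cV[R]_n) : R :=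
  \sum_b u b 0 ^+ 2.

(* Base stations are the elements of 'I_nB and slices those of V.  The mean
   reciprocal capacity [delta v] does not depend on the base station. *)
Record network (R : realType) (nB : nat) (V : finType) := Network {
  share : V -> R;
  btd : V -> R; (* mean-delay requirement d_v *)
  delta : V -> R;
  arrival : V -> 'rV[R]_nB;
  sojourn : V -> 'rV[R]_nB;
  routing : V -> 'M[R]_nB;
  share_gt0 : forall v, 0 < share v;
  share_sum : \sum_v share v = 1;
  delta_gt0 : forall v, 0 < delta v;
  btd_gt1 : forall v, 1 < share v * (btd v / delta v);
  arrival_gt0 : forall v b, 0 < arrival v 0 b;
  sojourn_gt0 : forall v b, 0 < sojourn v 0 b;
  routing_ge0 : forall v b c, 0 <= routing v b c;
  routing_sub : forall v b, \sum_c routing v b c <= 1;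
  (* The sum is the probability that a customer who starts at b is still in
     the network after k hops: customers eventually leave. *)
  routing_leave : forall v b,
    (fun k : nat => \sum_c (routing v ^+ k) b c) @ \oo --> (0 : R)
}.

Section Game.
Context {R : realType} {nB : nat} {V : finType} (N : network R nB V).
Implicit Types (v w : V) (b : 'I_nB).

Definition nbtd v : R := btd N v / delta N v.

(* Carrying a total load rho > 0 distributed as the relative load r requires
   the admission probabilities rho *: (Mmx v *m r). *)
Definition Mmx v : 'M[R]_nB :=
  invmx (diag_mx (arrival N v)) *m (1%:M - (routing N v)^T)
    *m invmx (diag_mx (sojourn N v)).

Definition Gamma v : set 'cV[R]_nB :=
  [set r | inner (const_mx 1) r = 1 /\ forall b, 0 <= (Mmx v *m r) b 0].

Definition gload (r : V -> 'cV[R]_nB) : 'cV[R]_nB :=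
  \sum_w share N w *: r w.

(* A strategy is a pair (relative load, reciprocal of the carried load). *)
Definition strategy : Type := ('cV[R]_nB * R)%type.
Definition carried_load (z : strategy) : R := (z.2)^-1.
Definition profile : Type := V -> strategy.
Definition loads (y : profile) : V -> 'cV[R]_nB := fun w => (y w).1.

Definition deviate (y : profile) v (z : strategy) : profile :=
  fun w => if w == v then z else y w.

(* The aggregate load is that of the profile in which v plays z, so it depends
   on z as well as on the other slices; the value [y v] is not used. *)
Definition Y v (y : profile) : set strategy :=
  [set z | [/\ inner (const_mx 1) z.1 = 1,
               forall b, 0 <= (Mmx v *m z.1) b 0 <= z.2 &
               inner (gload (loads (deviate y v z))) z.1
                 <= share N v * (nbtd v - 1) * z.2]].

Definition best_response v (y : profile) (z : strategy) : Prop :=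
  is_argmin (Y v y) snd z.

Definition nash_equilibrium (y : profile) : Prop :=
  forall v, best_response v y (y v).

(* Here a pair is (relative load, carried load). *)
Definition SS v : set ('cV[R]_nB * R) :=
  [set z | [/\ 0 < z.2,
               forall b, 0 <= (z.2 *: (Mmx v *m z.1)) b 0 <= 1,
               inner (const_mx 1) z.1 = 1 &
               z.2 * sqnorm z.1 <= share N v * nbtd v - 1]].

Definition saturated_game : Prop :=
  forall v (y : profile), (forall w, w != v -> Gamma w (y w).1) ->
  forall z, best_response v y z -> forall b, (Mmx v *m z.1) b 0 < z.2.

Definition saturated_SS : Prop :=
  forall v z, is_argmax (SS v) snd z ->
  forall b, (z.2 *: (Mmx v *m z.1)) b 0 < 1.

Definition saturated : Prop := saturated_game /\ saturated_SS.

Definition Gamma_profile : set (V -> 'cV[R]_nB) :=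
  [set r | forall v, Gamma v (r v)].

Definition potential (r : V -> 'cV[R]_nB) : R :=
  sqnorm (\sum_v share N v *: r v) + \sum_v share N v ^+ 2 * sqnorm (r v).

End Game.

(* Main.v *)
(* At an equilibrium y, saturation leaves the delay bound as the only active
   upper bound on x_v, so moving the load r_v of slice v towards any r' in
   Gamma^v cannot decrease the delay term to first order:
   <g + s^v r_v, r' - r_v> >= 0.  Weighted by s^v and summed over v, these
   inequalities say that half the differential of the potential at the
   equilibrium is nonnegative on the product of the Gamma^v; as the potential
   is a strictly convex quadratic form, the equilibrium loads are its unique
   minimizer. *)
Require Import Defs.
From mathcomp Require Import all_boot all_order all_algebra.
From mathcomp Require Import all_classical all_reals all_analysis.
From mathcomp Require Import ring lra.
Import Order.TTheory GRing.Theory Num.Theory.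
Import numFieldNormedType.Exports.
Local Open Scope classical_set_scope.
Local Open Scope ring_scope.

(** Keeps strict inequalities alive along a short initial piece of a segment: both the saturated
    bounds and the sign of a descent rate persist. *)
Lemma near_affine_lt (R : realType) (a k x : R) :
  a < x -> \forall t \near 0^'+, a + t * k < x.
Proof.
move=> ax; have k1_gt0 : 0 < `|k| + 1 by rewrite ltr_pwDr.
near=> t.
have t_gt0 : 0 < t by near: t; exact: nbhs_right_gt.
have : t < (x - a) / (`|k| + 1).
  by near: t; apply: nbhs_right_lt; rewrite divr_gt0 ?subr_gt0.
rewrite ltr_pdivlMr // -ltrBrDl; apply: le_lt_trans.
by rewrite ler_pM2l // (le_trans (ler_norm k)) // lerDl.
Unshelve. all: by end_near. Qed.

Section Inner.
Context {R : realType} {n : nat}.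
Implicit Types (u v w : 'cV[R]_n) (a : R).

Lemma innerC u w : inner u w = inner w u.
Proof. by apply: eq_bigr => b _; rewrite mulrC. Qed.

Lemma innerDl u v w : inner (u + v) w = inner u w + inner v w.
Proof. by rewrite -big_split; apply: eq_bigr => b _; rewrite mxE mulrDl. Qed.

Lemma innerZl a u w : inner (a *: u) w = a * inner u w.
Proof. by rewrite mulr_sumr; apply: eq_bigr => b _; rewrite mxE mulrA. Qed.

Lemma innerDr u v w : inner u (v + w) = inner u v + inner u w.
Proof. by rewrite innerC innerDl !(innerC u). Qed.

Lemma innerZr a u w : inner u (a *: w) = a * inner u w.
Proof. by rewrite innerC innerZl innerC. Qed.

Lemma innerBr u v w : inner u (v - w) = inner u v - inner u w.
Proof. by rewrite innerDr -scaleN1r innerZr mulN1r. Qed.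

Lemma inner_suml (I : finType) (F : I -> 'cV[R]_n) w :
  inner (\sum_i F i) w = \sum_i inner (F i) w.
Proof.
rewrite /inner exchange_big; apply: eq_bigr => b _.
by rewrite summxE mulr_suml.
Qed.

Lemma sqnormE u : sqnorm u = inner u u.
Proof. by apply: eq_bigr => b _; rewrite expr2. Qed.

Lemma sqnormD u w : sqnorm (u + w) = sqnorm u + 2 * inner u w + sqnorm w.
Proof. by rewrite !sqnormE innerDl !innerDr (innerC w u); ring. Qed.

Lemma sqnorm_ge0 u : 0 <= sqnorm u.
Proof. by apply: sumr_ge0 => b _; rewrite sqr_ge0. Qed.

Lemma sqnorm_eq0 u : sqnorm u = 0 -> u = 0.
Proof.
move/psumr_eq0P => u0; apply/colP => b; rewrite mxE; apply/eqP.
by rewrite -sqrf_eq0 u0 // => i _; rewrite sqr_ge0.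
Qed.

End Inner.

Section Game.
Context {R : realType} {nB : nat} {V : finType} {N : network R nB V}.
Implicit Types (v : V) (y : profile (R := R) (nB := nB) (V := V))
  (r : V -> 'cV[R]_nB).

(** The requirement gives s d > 1, while s <= 1 because the positive shares sum to 1. *)
Lemma delay_slack_gt0 v : 0 < share N v * (nbtd N v - 1).
Proof.
have s_le1 : share N v <= 1.
  rewrite -(share_sum N) (bigD1 v) //= lerDl.
  by apply: sumr_ge0 => w _; exact/ltW/share_gt0.
by have := btd_gt1 N v; rewrite /nbtd mulrBr mulr1; lra.
Qed.

Lemma gload_deviate y v (z : strategy) :
  gload N (loads (deviate y v z)) =
  gload N (loads y) + share N v *: (z.1 - (y v).1).
Proof.
rewrite /gload (bigD1 v) //= [in RHS](bigD1 v) //= /loads /deviate eqxx.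
under eq_bigr => w /negPf -> do [].
by rewrite scalerBr addrC [X in _ = X + _]addrC -addrA
  [_ + (_ - _)]addrC subrK.
Qed.

Lemma deviate_id y v : loads (deviate y v (y v)) = loads y.
Proof. by apply/funext => w; rewrite /loads /deviate; case: eqP => // ->. Qed.

(** If every upper bound on [u] were strict at [z.2], the same load would remain feasible with a
    slightly smaller x, against the minimality of [z.2]. *)
Lemma best_response_not_slack v y (z : strategy) (u : 'cV[R]_nB) :
    best_response N v y z -> Gamma N v u ->
    (forall b, (Mmx N v *m u) b 0 < z.2) ->
  share N v * (nbtd N v - 1) * z.2
    <= inner (gload N (loads (deviate y v (u, z.2)))) u.
Proof.
move=> [_ zmin] [u1 Mu_ge0] Mu_lt; rewrite leNgt; apply/negP => slack.
have [x' [x'_lt Mu_x' slack']] : exists x', [/\ x' < z.2,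
    forall b, (Mmx N v *m u) b 0 < x' &
    inner (gload N (loads (deviate y v (u, z.2)))) u
      < share N v * (nbtd N v - 1) * x'].
  near (z.2)^'- => x'; exists x'; split.
  - by near: x'; exact: nbhs_left_lt.
  - by near: x'; apply: filter_forall => b; exact: nbhs_left_gt.
  (* Division by the positive slack coefficient turns the delay bound into a lower bound on x' lying
     strictly below [z.2]. *)
  rewrite -ltr_pdivrMl ?delay_slack_gt0 //; near: x'; apply: nbhs_left_gt.
  by rewrite ltr_pdivrMl ?delay_slack_gt0.
suff /zmin : Y N v y (u, x') by rewrite /= leNgt x'_lt.
split=> //= [b|]; first by rewrite Mu_ge0 ltW.
(* The aggregate load sees only the load component of a deviation, so passing from [z.2] to x'
   leaves it unchanged. *)
by move: slack'; rewrite !gload_deviate; exact: ltW.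
Unshelve. all: by end_near. Qed.

Section Equilibrium.
Context {y} (Hsat : saturated_game N) (Hy : nash_equilibrium N y).

Lemma nash_Gamma v : Gamma N v (y v).1.
Proof. by have [[y1 My _] _] := Hy v; split=> // b; case/andP: (My b). Qed.

Lemma nash_saturated v b : (Mmx N v *m (y v).1) b 0 < (y v).2.
Proof. by apply: (Hsat _ y _ _ (Hy v)) => w _; exact: nash_Gamma. Qed.

Lemma nash_delay_active v :
  inner (gload N (loads y)) (y v).1 = share N v * (nbtd N v - 1) * (y v).2.
Proof.
have [[_ _]] := Hy v; rewrite deviate_id => ub _; apply/eqP.
rewrite eq_le ub /=.
have := best_response_not_slack _ _ _ _ (Hy v) (nash_Gamma v) (nash_saturated v).
by rewrite -surjective_pairing deviate_id.
Qed.

Lemma nash_variational v u : Gamma N v u ->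
  0 <= inner (gload N (loads y) + share N v *: (y v).1) (u - (y v).1).
Proof.
move=> [u1 Mu]; have [r1 Mr] := nash_Gamma v.
set g := gload N (loads y); set r := (y v).1; set s := share N v.
have [h hE] : exists h, h = u - r by exists (u - r).
rewrite -hE leNgt; apply/negP => descent.
near (0 : R)^'+ => t.
have t_gt0 : 0 < t by near: t; exact: nbhs_right_gt.
have t_lt1 : t < 1 by near: t; exact: nbhs_right_lt.
have Mt b : (Mmx N v *m (r + t *: h)) b 0
    = (Mmx N v *m r) b 0 + t * (Mmx N v *m h) b 0.
  by rewrite mulmxDr -scalemxAr !mxE.
have Gt : Gamma N v (r + t *: h).
  split=> [|b]; first by rewrite innerDr innerZr hE innerBr u1 r1 subrr mulr0 addr0.
  (* M (r + t h) = (1 - t) M r + t M u is a convex combination of nonnegative vectors. *)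
  rewrite Mt hE mulmxBr [X in t * X]mxE [X in t * (_ + X)]mxE.
  have := Mu b; have := Mr b; rewrite -/r; nra.
have Mt_lt b : (Mmx N v *m (r + t *: h)) b 0 < (y v).2.
  rewrite Mt; move: b; near: t; apply: filter_forall => b.
  exact/near_affine_lt/nash_saturated.
have := best_response_not_slack _ _ _ _ (Hy v) Gt Mt_lt.
rewrite gload_deviate -nash_delay_active /= -/g -/r -/s addrAC subrr add0r.
(* The delay term at r + t h, with aggregate g + t s h, exceeds <g, r> by exactly t times this
   quantity. Its negativity contradicts the absence of slack. *)
have : inner (g + s *: r) h + t * (s * inner h h) < 0.
  by near: t; exact: near_affine_lt.
rewrite !(innerDl, innerDr, innerZl, innerZr) (innerC h r); nra.
Unshelve. all: by end_near. Qed.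

End Equilibrium.

(** The potential is a quadratic form, so its second-order expansion is exact and the remainder is
    the form itself at the difference. *)
Lemma potential_expand r (r' : V -> 'cV[R]_nB) :
  potential N r' = potential N r
    + 2 * \sum_v share N v * inner (gload N r + share N v *: r v) (r' v - r v)
    + potential N (fun v => r' v - r v).
Proof.
have -> : \sum_v share N v * inner (gload N r + share N v *: r v) (r' v - r v)
    = inner (gload N r) (gload N (fun v => r' v - r v))
      + \sum_v share N v ^+ 2 * inner (r v) (r' v - r v).
  rewrite [in RHS]innerC inner_suml -big_split; apply: eq_bigr => v _ /=.
  by rewrite innerDl !innerZl (innerC _ (gload N r)); ring.
rewrite /potential -!/(gload N _).
have -> : gload N r' = gload N r + gload N (fun v => r' v - r v).
  rewrite -big_split; apply: eq_bigr => v _ /=.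
  by rewrite -scalerDr addrC subrK.
have -> : \sum_v share N v ^+ 2 * sqnorm (r' v)
    = \sum_v share N v ^+ 2 * sqnorm (r v)
      + 2 * (\sum_v share N v ^+ 2 * inner (r v) (r' v - r v))
      + \sum_v share N v ^+ 2 * sqnorm (r' v - r v).
  rewrite mulr_sumr -!big_split; apply: eq_bigr => v _ /=.
  rewrite -{1}[r' v](subrK (r v)) [X in sqnorm X]addrC (sqnormD (r v)); ring.
by rewrite sqnormD; ring.
Qed.

Lemma potential_ge0 r : 0 <= potential N r.
Proof.
rewrite addr_ge0 ?sqnorm_ge0 // sumr_ge0 // => v _.
by rewrite mulr_ge0 ?sqr_ge0 ?sqnorm_ge0.
Qed.

(** Definiteness comes from the second sum, whose weights are positive; the aggregate term alone
    could vanish by cancellation. *)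
Lemma potential_le0 r v : potential N r <= 0 -> r v = 0.
Proof.
have sq_ge0 w : true -> 0 <= share N w ^+ 2 * sqnorm (r w).
  by rewrite mulr_ge0 ?sqr_ge0 ?sqnorm_ge0.
move=> le0; have sum0 : \sum_w share N w ^+ 2 * sqnorm (r w) = 0.
  apply/eqP; rewrite eq_le sumr_ge0 // andbT (le_trans _ le0) //.
  by rewrite lerDr sqnorm_ge0.
have /eqP := (psumr_eq0P sq_ge0 sum0) v isT.
rewrite mulf_eq0 sqrf_eq0 (gt_eqF (share_gt0 N v)) => /eqP.
exact: sqnorm_eq0.
Qed.

End Game.

Theorem theorem5 (R : realType) (nB : nat) (V : finType)
    (nB_gt0 : (0 < nB)%N) (V_gt0 : (0 < #|V|)%N)
    (N : network R nB V) (Hsat : saturated N)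
    (y : profile (R := R) (nB := nB) (V := V)) (Hy : nash_equilibrium N y) :
  is_argmin (Gamma_profile N) (potential N) (loads y) /\
  (forall r, is_argmin (Gamma_profile N) (potential N) r -> r = loads y) /\
  (forall v, 0 < (y v).2 /\
     carried_load (y v) =
       share N v * (nbtd N v - 1) / inner (gload N (loads y)) (y v).1).
Proof.
have [Hg _] := Hsat.
have GyP : Gamma_profile N (loads y) by move=> v; exact: nash_Gamma.
(* The linear term of the expansion is nonnegative by the variational inequalities; the surviving
   remainder yields both minimality and uniqueness. *)
have growth r : Gamma_profile N r ->
    potential N (loads y) + potential N (fun v => r v - loads y v)
      <= potential N r.
  move=> Gr; rewrite (potential_expand (loads y) r) lerD2r lerDl mulr_ge0 //.
  apply: sumr_ge0 => v _; apply: mulr_ge0; first exact/ltW/share_gt0.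
  exact: nash_variational.
split; [|split].
- split=> // r /growth; apply: le_trans.
  by rewrite lerDl potential_ge0.
(* Another minimizer does no worse than the equilibrium, so growth forces the potential of the
   difference to be at most 0. *)
- move=> r [/growth Gr /(_ _ GyP) le_r]; apply/funext => v.
  apply/subr0_eq; apply: (@potential_le0 _ _ _ N (fun v => r v - loads y v)).
  by move: (le_trans Gr le_r); rewrite gerDl.
- move=> v.
  have x_gt0 : 0 < (y v).2.
    (* At any one base station, 0 <= M r < x by saturation. *)
    have [_ /(_ (Ordinal nB_gt0)) Mr_ge0] := nash_Gamma Hy v.
    exact: le_lt_trans Mr_ge0 (nash_saturated Hg Hy v _).
  split=> //; rewrite nash_delay_active // /carried_load invfM mulrA divff ?mul1r //.
  by rewrite gt_eqF ?delay_slack_gt0.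
Qed.
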